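(* Fix any $\alpha\in(0,1)$. There exists a constant $\beta\in(0,1)$ such that for every $n\in\mathbb{N}$ the following holds. For every integer $0\le k\le n^{\beta}$ there exists a property $\Pi_k\subseteq\Sigma_n^{N}$, where $\Sigma_n=\{0,\dots,n-1\}$ and $N=n^{1+\alpha}$ (rounded), such that for any constant $\varepsilon\in(0,1]$: (i) there exists a $(k,\tilde O(k))$-round-adaptive tester for $\Pi_k$ with one-sided error; yet (ii) any $(k,q)$-tail-adaptive (two-sided error) tester for $\Pi_k$ must satisfy $q=\Omega(n)$.
   Context: Relative Hamming distance from $\Pi$ and $\varepsilon$-far are as usual. A $(k,q)$-round-adaptive tester: given proximity parameter $\varepsilon$ and query access to $w\in\Sigma^N$, proceeds in $k+1$ rounds, in round $\ell\ge0$ choosing a set $Q_\ell$ of coordinates based on its randomness and answers to earlier rounds and receiving $w$ on $Q_\ell$, with $\sum_\ell|Q_\ell|=q$; accepts $w\in\Pi$ w.p. $\ge2/3$ and rejects $\varepsilon$-far $w$ w.p. $\ge2/3$; one-sided means members of $\Pi$ are always accepted. A $(k,q)$-tail-adaptive tester: given proximity parameter $\varepsilon$, error parameter $\delta\in(0,1]$, and query access to $w$, first queries a set $Q$ chosen using only its internal randomness, and then, over the next $k$ rounds, makes $k$ single adaptive queries $x^{(1)},\dots,x^{(k)}$ (each depending on all previous answers), with $q=|Q|+k$; it accepts $w\in\Pi$ with probability $\ge1-\delta$ and rejects $\varepsilon$-far $w$ with probability $\ge1-\delta$. The implicit constants in $\tilde O,\Omega$ may depend on $\alpha,\varepsilon$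 but not on $n,k$.
   Formalization: Since the claim fails there, (i) has no query bound at k=0 (a non-adaptive O(1)-query tester would violate (ii)), and (ii) is stated only for ε<1 and error δ<1/2 (else q=k suffices); the constant and threshold in Ω(n) may depend on δ. *)

(* Defs.v *)
From HB Require Import structures.
From mathcomp Require Export all_boot all_order all_algebra.
From mathcomp Require Export reals exp.

Set Implicit Arguments.
Unset Strict Implicit.
Unset Printing Implicit Defensive.

Import Order.TTheory GRing.Theory Num.Theory.
Local Open Scope ring_scope.

Definition word (n N : nat) := {ffun 'I_N -> 'I_n}.

(* n^(1 + alpha), rounded to the nearest integer. *)
Definition block_length (R : realType) (alpha : R) (n : nat) : nat :=
  Num.truncn (n%:R `^ (1 + alpha) + 2^-1 : R).

Section Testers.
Variables (R : realType) (n N : nat).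

Definition reldist (v w : word n N) : R :=
  #|[set i | v i != w i]|%:R / N%:R.

Definition far (Pi : {set word n N}) (eps : R) (w : word n N) : Prop :=
  forall v, v \in Pi -> eps < reldist v w.

(* What a query set reveals: [Some (w i)] on the set, [None] elsewhere. *)
Definition answers := {ffun 'I_N -> option 'I_n}.

Definition reply (w : word n N) (Q : {set 'I_N}) : answers :=
  [ffun i => if i \in Q then Some (w i) else None].

(* A randomized query algorithm working in rounds: [coins] is its internal
   randomness, distributed according to [prob]; [ask c h] is the set queried
   in round [size h] when the coins are [c] and [h] lists the answers received
   in the earlier rounds.  As [c] is fixed along a run, [h] and [c] determine
   all the earlier query sets as well. *)
Record algorithm := Algorithm {
  coins : finType;
  prob : coins -> R;
  prob_ge0 : forall c, 0 <= prob c;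
  prob_sum1 : \sum_c prob c = 1;
  ask : coins -> seq answers -> {set 'I_N};
  verdict : coins -> seq answers -> bool
}.

Section Run.
Variables (T : algorithm) (w : word n N) (c : coins T).

Fixpoint transcript (l : nat) : seq answers :=
  if l is l'.+1 then rcons (transcript l') (reply w (ask c (transcript l')))
  else [::].

Definition queries (l : nat) : {set 'I_N} := ask c (transcript l).

End Run.

(* The rounds are numbered from 0 to [k], hence [k.+1] replies. *)
Definition accepts (T : algorithm) (k : nat) (w : word n N) (c : coins T) :=
  verdict c (transcript w c k.+1).

Definition Pr_accept (T : algorithm) (k : nat) (w : word n N) : R :=
  \sum_(c : coins T | accepts k w c) prob c.

Definition Pr_reject (T : algorithm) (k : nat) (w : word n N) : R :=
  \sum_(c : coins T | ~~ accepts k w c) prob c.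

Definition tests (T : algorithm) (k : nat) (Pi : {set word n N})
    (eps delta : R) : Prop :=
  (forall w, w \in Pi -> 1 - delta <= Pr_accept T k w) /\
  (forall w, far Pi eps w -> 1 - delta <= Pr_reject T k w).

Definition one_sided (T : algorithm) (k : nat) (Pi : {set word n N}) : Prop :=
  forall w, w \in Pi -> Pr_accept T k w = 1.

Definition round_adaptive_tester (k q : nat) (Pi : {set word n N}) (eps : R)
    (T : algorithm) : Prop :=
  (forall (w : word n N) (c : coins T),
     (\sum_(l < k.+1) #|queries w c l|)%N = q) /\
  tests T k Pi eps 3^-1.

(* [queries w c 0] is [ask c [::]]: it depends on the coins only. *)
Definition tail_adaptive_tester (k q : nat) (Pi : {set word n N})
    (eps delta : R) (T : algorithm) : Prop :=
  (forall (w : word n N) (c : coins T),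
     (forall l : nat, (1 <= l <= k)%N -> #|queries w c l| = 1%N) /\
     (#|queries w c 0| + k)%N = q) /\
  tests T k Pi eps delta.

End Testers.

(* Main.v *)
Require Import Defs.
From mathcomp Require Import ring lra zify.

Set Implicit Arguments.
Unset Strict Implicit.
Unset Printing Implicit Defensive.

Import Order.TTheory GRing.Theory Num.Theory.
Local Open Scope ring_scope.

(* A codeword splits into auxiliary cells, which are unconstrained and make up
   only [o(N)] of the word, and main cells, which are functions of them: with
   [T] tables [S_j] of about [n^(1 + alpha/2)] symbols each, the main cell [x]
   carries the sum over [j] of [S_j[p_j(block x) + x]], the shifts [p_j(b)] also
   being stored in auxiliary cells.

   Since the auxiliary cells are free, the distance of [w] to the property is at
   most the fraction of main cells that disagree with the auxiliary cells of
   [w], so a few random main cells are enough: their shifts are read in round 0,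
   the table entries in round 1.

   For a query set [Q] of size at most [n] fixed in advance, random shifts make
   each main cell have only [O(1)] of its [T] table entries queried or shared
   with another main cell of [Q]; [k] further cells spoil [O(k)] more.  With [T]
   a large enough multiple of [k + 1], every queried main cell thus depends on a
   table entry that nothing else seen by a tail-adaptive tester depends on, and
   so a random codeword is indistinguishable from a uniform word.  The latter is
   far from the property, by counting. *)

(** * Words agreeing on a set of cells *)

Section Agreement.
Variables n N : nat.
Implicit Types (P : {set 'I_N}) (u v w : word n N).

Definition agree P v w := [forall i in P, v i == w i].

Lemma agreeP P v w : reflect {in P, v =1 w} (agree P v w).
Proof. exact: 'forall_in_eqP. Qed.

Lemma agreeC P v w : agree P v w = agree P w v.
Proof. by apply/agreeP/agreeP => h i iP; rewrite h. Qed.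

Lemma agreeS P P' v w : P \subset P' -> agree P' v w -> agree P v w.
Proof. by move=> /subsetP s /agreeP h; apply/agreeP => i /s; apply: h. Qed.

Lemma card_le_ord P : (#|P| <= N)%N.
Proof. by rewrite (leq_trans (max_card _)) ?card_ord. Qed.

Lemma card_setCN P : #|~: P| = (N - #|P|)%N.
Proof. by rewrite cardsCs setCK card_ord. Qed.

Lemma card_word : #|{: word n N}| = (n ^ N)%N.
Proof. by rewrite card_ffun !card_ord. Qed.

Lemma card_agree P w : #|[set v | agree P v w]| = (n ^ (N - #|P|))%N.
Proof.
pose F i : pred 'I_n := if i \in P then pred1 (w i) else predT.
have -> : #|[set v | agree P v w]| = #|family F|.
  apply: eq_card => v; rewrite inE; apply/agreeP/familyP => h i.
    by rewrite /F; case: ifP => // iP; rewrite inE h.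
  by move=> iP; move: (h i); rewrite /F iP inE => /eqP.
rewrite card_family foldrE big_image /= (bigID (mem P)) /=.
rewrite big1 => [|i iP]; last by rewrite /F iP card1.
rewrite mul1n (eq_bigr (fun=> n)) => [|i /negbTE iP]; last first.
  by rewrite /F iP card_ord.
rewrite prod_nat_const; congr (_ ^ _)%N.
by rewrite -card_setCN; apply: eq_card => i; rewrite !inE.
Qed.

(* Double counting of the pairs [(w, v)] such that [v \in E] and [w] agrees
   with [v] off [P]. *)
Lemma card_resample (E : {set word n N}) P (a : nat) :
    (forall v, #|[set w in E | agree (~: P) w v]| <= a)%N ->
  (#|E| * n ^ #|P| <= n ^ N * a)%N.
Proof.
move=> h.
have -> : (#|E| * n ^ #|P| =
           \sum_(w in E) \sum_(v : word n N | agree (~: P) v w) 1)%N.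
  rewrite -sum_nat_const; apply: eq_bigr => w _.
  rewrite sum1_card.
  have -> : #|[pred v | agree (~: P) v w]| = #|[set v | agree (~: P) v w]|.
    by apply: eq_card => v; rewrite !inE.
  rewrite card_agree; congr (_ ^ _)%N.
  by rewrite card_setCN subKn ?card_le_ord.
rewrite (exchange_big_dep xpredT) //= -card_word -sum_nat_const.
apply: leq_sum => v _; rewrite sum1_card; apply: leq_trans (h v).
by apply: subset_leq_card; apply/subsetP => w; rewrite !inE agreeC.
Qed.

(* [W w] is the set of cells inspected on input [w].  Both cardinals, times
   [n ^ N], count the pairs [(w, v)] for which the runs on [f w] and on [v]
   coincide, each pair being weighted by [n ^ #|W v|]. *)
Lemma card_transfer (f : word n N -> word n N) (W : word n N -> {set 'I_N})
    (acc good : pred (word n N)) : (0 < n)%N ->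
    (forall w v, agree (W w) v w ->
       [/\ W v = W w, acc v = acc w & good v = good w]) ->
    (forall w, good (f w) = good w) ->
    (forall v, good v ->
       #|[set w | agree (W v) (f w) v]| = (n ^ (N - #|W v|))%N) ->
  #|[set w | good w && acc (f w)]| = #|[set w | good w && acc w]|.
Proof.
move=> n0 loc gf unif; apply/eqP.
have nN : (0 < n ^ N)%N by rewrite expn_gt0 n0.
rewrite -(eqn_pmul2r nN) -!sum_nat_const; apply/eqP.
have WN v : (n ^ (N - #|W v|) * n ^ #|W v| = n ^ N)%N.
  by rewrite -expnD subnK ?card_le_ord.
transitivity (\sum_(w : word n N) \sum_(v in [set v | good v && acc v] |
    agree (W v) (f w) v) n ^ #|W v|)%N.
  rewrite [LHS]big_mkcond; apply: eq_bigr => w _; rewrite inE.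
  have key v : (v \in [set v | good v && acc v]) && agree (W v) (f w) v =
      (good w && acc (f w)) && agree (W (f w)) v (f w).
    rewrite inE; apply/andP/andP => -[/andP[gv av] h].
      have [e1 e2 e3] := loc _ _ h; rewrite -gf e3 gv e2 av e1.
      by split=> //; rewrite agreeC.
    have [e1 e2 e3] := loc _ _ h; rewrite e2 e3 gf gv av e1.
    by split=> //; rewrite agreeC.
  rewrite (eq_bigl _ _ key); case: ifP => _ /=; last by rewrite big_pred0_eq.
  rewrite (eq_bigr (fun=> n ^ #|W (f w)|)%N); last first.
    by move=> v h; have [-> _ _] := loc _ _ h.
  rewrite sum_nat_const -(WN (f w)) -(card_agree _ (f w)).
  by congr (_ * _)%N; apply: eq_card => v; rewrite !inE.
rewrite (exchange_big_dep (mem [set v | good v && acc v])) //=; last first.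
  by move=> w v _ /andP[].
apply: eq_bigr => v; rewrite inE => /andP[gv av].
rewrite sum_nat_const -[RHS](WN v) -unif //.
by congr (_ * _)%N; apply: eq_card => w; rewrite !inE gv av.
Qed.

End Agreement.

(** * Counting *)

Lemma exists_set_between (U : finType) (A B : {set U}) (s : nat) :
    A \subset B -> (#|A| <= s <= #|B|)%N ->
  exists C : {set U}, [/\ A \subset C, C \subset B & #|C| = s].
Proof.
move=> AB /andP[As sB].
pose C := A :|: [set x in take (s - #|A|) (enum (B :\: A))].
have subBA x : x \in take (s - #|A|) (enum (B :\: A)) -> x \in B :\: A.
  by move/mem_take; rewrite mem_enum.
exists C; split; first exact: subsetUl.
  apply/subsetP => x; rewrite !inE => /orP[/(subsetP AB) //|/subBA].
  by rewrite inE => /andP[].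
rewrite cardsU disjoint_setI0 ?cards0 ?subn0; last first.
  rewrite disjoint_sym; apply/pred0P => x /=; rewrite inE.
  by apply/negP => /andP[/subBA]; rewrite inE => /andP[/negbTE ->].
rewrite cardsE (card_uniqP _) ?take_uniq ?enum_uniq // size_takel ?subnKC //.
by rewrite -cardE cardsD (setIidPr AB) leq_sub2r.
Qed.

Lemma leq_card_bigcup (U I : finType) (P : pred I) (F : I -> {set U}) :
  (#|\bigcup_(i | P i) F i| <= \sum_(i | P i) #|F i|)%N.
Proof.
elim/big_rec2: _ => [|i b A _ le]; first by rewrite cards0.
by rewrite (leq_trans (leq_card_setU _ _)) // leq_add2l.
Qed.

Lemma bin_le_exp m t : ('C(m, t) <= m ^ t)%N.
Proof.
apply: (@leq_trans (m ^_ t)).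
  by rewrite -bin_ffact leq_pmulr // fact_gt0.
elim: t m => [|t IH] m; first by rewrite ffactn0.
rewrite ffactnS expnS leq_mul2l (leq_trans (IH _)) ?orbT //.
by case: t {IH} => // t; rewrite leq_exp2r // leq_pred.
Qed.

Lemma card_ffun_many_hits (U : finType) (m t a : nat) (A : 'I_m -> {set U}) :
    (t <= m)%N -> (forall j, #|A j| <= a)%N ->
  (#|[set y : {ffun 'I_m -> U} | t <= #|[set j | y j \in A j]|]|
     <= m ^ t * (a ^ t * #|U| ^ (m - t)))%N.
Proof.
move=> tm Aa.
pose F (J : {set 'I_m}) := [set y : {ffun 'I_m -> U} | [forall j in J, y j \in A j]].
apply: (@leq_trans #|\bigcup_(J : {set 'I_m} | #|J| == t) F J|).
  apply/subset_leq_card/subsetP => y; rewrite inE => ty.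
  have [|J [_ sJ cJ]] := @exists_set_between _ set0 _ t (sub0set [set j | y j \in A j]).
    by rewrite cards0.
  apply/bigcupP; exists J; first exact/eqP.
  rewrite inE; apply/forall_inP => j /(subsetP sJ).
  by rewrite inE.
apply: leq_trans (leq_card_bigcup _ _) _.
apply: (@leq_trans (\sum_(J : {set 'I_m} | #|J| == t) a ^ t * #|U| ^ (m - t))).
  apply: leq_sum => J /eqP cJ.
  pose G j : {set U} := if j \in J then A j else setT.
  have -> : #|F J| = #|family G|.
    apply: eq_card => y; rewrite inE; apply/forall_inP/familyP => h j.
      by rewrite /G; case: ifP => [/h|]; rewrite ?in_setT.
    by move=> jJ; move: (h j); rewrite /G jJ.
  rewrite card_family foldrE big_image /= (bigID (mem J)) /=.
  rewrite leq_mul //.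
    rewrite -[in leqRHS]cJ -prod_nat_const; apply: leq_prod => j jJ.
    by rewrite /G jJ; apply: Aa.
  rewrite (eq_bigr (fun=> #|U|)) => [|j /negbTE jJ]; last by rewrite /G jJ cardsT.
  rewrite prod_nat_const -cJ -card_setCN.
  by apply: eq_leq; congr (_ ^ _)%N; apply: eq_card => j; rewrite !inE.
rewrite sum_nat_const leq_mul2r; apply/orP; right.
have := card_draws 'I_m t; rewrite card_ord => e.
apply: leq_trans (bin_le_exp m t); rewrite -e.
by apply/subset_leq_card/subsetP => J; rewrite !inE.
Qed.

Lemma bernoulli_ineq (R : realType) (x : R) m : 0 <= x -> 1 + x *+ m <= (1 + x) ^+ m.
Proof.
move=> x0; elim: m => [|m IH]; first by rewrite mulr0n addr0.
rewrite exprS mulrS; apply: (@le_trans _ _ ((1 + x) * (1 + x *+ m))).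
  have h : 0 <= x * (x *+ m) by rewrite mulr_ge0 // mulrn_wge0.
  by rewrite mulrDl mul1r mulrDr mulr1; lra.
by rewrite ler_wpM2l // addr_ge0.
Qed.

Lemma Pr_acceptD (R : realType) n N (A : algorithm R n N) k (w : word n N) :
  Pr_accept A k w + Pr_reject A k w = 1.
Proof. by rewrite -(prob_sum1 A) [RHS](bigID (fun c => accepts k w c)). Qed.

(** * One-round testers *)

Section OneRound.
Variables (R : realType) (n N : nat) (Pi : {set word n N}) (Q : {set 'I_N}).
Hypothesis PiQ : forall v w, agree Q v w -> v \in Pi -> w \in Pi.

Fact one_round_ge0 (c : unit) : 0 <= 1 :> R. Proof. exact: ler01. Qed.

Fact one_round_sum1 : \sum_(c : unit) 1 = 1 :> R.
Proof. by rewrite sumr_const card_unit. Qed.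

Definition one_round : algorithm R n N :=
  Algorithm one_round_ge0 one_round_sum1
    (fun (c : unit) h => if h is [::] then Q else set0)
    (fun (c : unit) h =>
       if h is a :: _ then [exists w in Pi, a == reply w Q] else false).

Lemma one_round_transcript w (c : unit) l : exists s,
  transcript (T := one_round) w c l.+1 = reply w Q :: s.
Proof.
elim: l => [|l [s IH]]; first by exists [::].
have -> : transcript (T := one_round) w c l.+2 =
  rcons (transcript (T := one_round) w c l.+1)
    (reply w (ask (a := one_round) c (transcript (T := one_round) w c l.+1))) by [].
by rewrite IH rcons_cons; eexists.
Qed.

Lemma one_round_accepts k w (c : unit) : accepts (T := one_round) k w c = (w \in Pi).
Proof.
have [s e] := one_round_transcript w c k; rewrite /accepts e /=.
apply/exists_inP/idP => [[v vPi /eqP/ffunP e']|wPi]; last by exists w.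
apply: PiQ vPi; apply/agreeP => i iQ.
by have := e' i; rewrite !ffunE iQ => -[].
Qed.

Lemma one_round_tester k (eps : R) : 0 < eps ->
  round_adaptive_tester k #|Q| Pi eps one_round /\ one_sided one_round k Pi.
Proof.
move=> e0.
have Pr w : Pr_accept one_round k w = (w \in Pi)%:R.
  rewrite /Pr_accept (eq_bigl (fun=> w \in Pi)) => [|c]; last exact: one_round_accepts.
  by case: (w \in Pi); rewrite ?big_pred0_eq //= one_round_sum1.
have os : one_sided one_round k Pi by move=> w wPi; rewrite Pr wPi.
do 2!split=> //.
  move=> w c; rewrite big_ord_recl big1 ?addn0 // => l _.
  have [s e] := one_round_transcript w c l.
  by rewrite -[nat_of_ord (lift _ _)]/(l.+1) /queries e /= cards0.
split=> w.
  by move=> /os ->; rewrite gerBl invr_ge0 ler0n.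
move=> wfar; have := Pr_acceptD one_round k w; rewrite Pr.
case: (boolP (w \in Pi)) => [/wfar|_]; last first.
  by rewrite add0r => ->; rewrite gerBl invr_ge0 ler0n.
rewrite /reldist (eq_card0 (A := [set i | w i != w i])) ?mul0r ?ltNge ?(ltW e0) //.
by move=> i; rewrite inE eqxx.
Qed.

End OneRound.

(** * The property and its testers *)

Section Construction.
Variables (n' N T V' B' : nat).
Local Notation n := n'.+1.
Local Notation V := V'.+1.
Local Notation B := B'.+1.

Implicit Types (v w : word n N) (x d : 'I_N) (D Q E : {set 'I_N}).

(* [inl (j, s)] is entry [s] of table [j]; [inr (j, b, _)] are the two base-[n]
   digits of the shift of table [j] for the block [b] of main cells. *)
Definition aux : finType := ('I_T * 'I_V + 'I_T * 'I_B * bool)%type.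

Hypothesis auxN : (#|aux| <= N)%N.
Hypothesis blocksN : (N <= B * V)%N.

Definition cell (a : aux) : 'I_N := widen_ord auxN (enum_rank a).

Lemma cell_inj : injective cell.
Proof. by move=> a b /(congr1 val) /= /val_inj /enum_rank_inj. Qed.

Definition share j s := cell (inl (j, s)).
Definition ptr j b e := cell (inr (j, b, e)).
Definition main : {set 'I_N} := [set x | x \notin codom cell].
Definition ptrs : {set 'I_N} := [set cell (inr p) | p in predT].

Definition blk (x : 'I_N) : 'I_B := inord (x %/ V).

Definition shift (w : word n N) j b : nat :=
  (w (ptr j b false) * n + w (ptr j b true))%N.

Definition loc w j (x : 'I_N) : 'I_V := inZp (shift w j (blk x) + x).

Definition parity w x := \sum_j w (share j (loc w j x)).

Definition encode (w : word n N) : word n N :=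
  [ffun x => if x \in main then parity w x else w x].

Definition codewords : {set word n N} := [set w | encode w == w].

Lemma share_inj j j' s s' : share j s = share j' s' -> j = j' /\ s = s'.
Proof. by move/cell_inj => [-> ->]. Qed.

Lemma cell_main a : (cell a \in main) = false.
Proof. by rewrite inE codom_f. Qed.

Lemma share_ptrs j s : share j s \notin ptrs.
Proof. by apply/imsetP => -[p _ /cell_inj]. Qed.

Lemma main_ptrs x : x \in main -> x \notin ptrs.
Proof. by apply: contraL => /imsetP[p _ ->]; rewrite cell_main. Qed.

Lemma encode_cell w a : encode w (cell a) = w (cell a).
Proof. by rewrite ffunE cell_main. Qed.

Lemma loc_ptrs v w j x : agree ptrs v w -> loc v j x = loc w j x.
Proof. by move=> /agreeP h; rewrite /loc /shift !h //; apply: imset_f. Qed.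

Lemma encode_ptrs w : agree ptrs (encode w) w.
Proof. by apply/agreeP => i /imsetP[p _ ->]; rewrite encode_cell. Qed.

Lemma encode_id w : encode (encode w) = encode w.
Proof.
apply/ffunP => x; rewrite [LHS]ffunE [RHS]ffunE.
case: ifP => xm; last by rewrite ffunE xm.
apply: eq_bigr => j _; rewrite encode_cell.
by rewrite (loc_ptrs _ _ (encode_ptrs w)).
Qed.

Lemma encode_codewords w : encode w \in codewords.
Proof. by rewrite inE encode_id. Qed.

Lemma val_blk x : blk x = (x %/ V)%N :> nat.
Proof.
by rewrite inordK // ltn_divLR // (leq_trans (ltn_ord x)).
Qed.

Lemma loc_same_block w j x y : blk x = blk y -> loc w j x = loc w j y -> x = y.
Proof.
rewrite /loc => e; rewrite -e => /(congr1 val) /= /eqP.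
rewrite eqn_modDl => /eqP em; apply: val_inj => /=.
by rewrite (divn_eq x V) (divn_eq y V) em -!val_blk e.
Qed.

(* Querying [d] compromises the share of [x] in table [j]. *)
Definition hits w x j d :=
  (d == share j (loc w j x)) ||
  [&& d \in main, d != x & loc w j d == loc w j x].

Definition nhits w x (D : {set 'I_N}) := #|[set j | [exists d in D, hits w x j d]]|.

Lemma hits_ptrs v w x j d : agree ptrs v w -> hits v x j d = hits w x j d.
Proof. by move=> h; rewrite /hits !(loc_ptrs _ _ h). Qed.

Lemma nhits_ptrs v w x D : agree ptrs v w -> nhits v x D = nhits w x D.
Proof.
move=> h; apply: eq_card => j; rewrite !inE.
by apply: eq_existsb => d; rewrite (hits_ptrs _ _ _ h).
Qed.

Lemma ptrs_hits w x j d : d \in ptrs -> hits w x j d = false.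
Proof.
move=> dp; apply/negbTE/negP => /orP[/eqP e|/andP[/main_ptrs]].
  by have := share_ptrs j (loc w j x); rewrite -e dp.
by rewrite dp.
Qed.

Lemma nhitsU w x D D' : (nhits w x (D :|: D') <= nhits w x D + nhits w x D')%N.
Proof.
rewrite /nhits; apply: leq_trans (leq_card_setU _ _).1.
apply/subset_leq_card/subsetP => j; rewrite !inE => /exists_inP[d].
rewrite inE => /orP[dD|dD] h; apply/orP; [left|right];
  by apply/'exists_in_idP; exists d.
Qed.

Lemma nhits_small w x (E : {set 'I_N}) t :
  (forall e, nhits w x [set e] <= t)%N -> (nhits w x E <= #|E| * t)%N.
Proof.
move=> h.
suff: forall s : seq 'I_N, (nhits w x [set e in s] <= size s * t)%N.
  by move/(_ (enum E)); rewrite set_enum -cardE.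
elim=> [|e s IH].
  rewrite /nhits eq_card0 // => j; rewrite inE.
  by apply/exists_inP => -[d]; rewrite inE.
by rewrite set_cons (leq_trans (nhitsU _ _ _ _)) //= mulSn leq_add.
Qed.

Definition good t Q w := [forall x in main,
  (nhits w x Q <= t)%N && [forall e, nhits w x [set e] <= t]%N].

Lemma good_ptrs t Q v w : agree ptrs v w -> good t Q v = good t Q w.
Proof.
move=> h; apply: eq_forallb => x; congr (_ ==> (_ && _)).
  by rewrite (nhits_ptrs _ _ h).
by apply: eq_forallb => e; rewrite (nhits_ptrs _ _ h).
Qed.

Lemma good_private t Q E w x : good t Q w -> x \in main ->
    (#|E|.+1 * t < T)%N ->
  exists j, forall d, d \in ptrs :|: Q :|: E -> ~~ hits w x j d.
Proof.
move=> /forall_inP h /h /andP[hQ /forallP hE] ltT.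
have : (nhits w x (Q :|: E) < T)%N.
  apply: leq_ltn_trans (nhitsU _ _ _ _) _; apply: leq_ltn_trans ltT.
  by rewrite mulSn leq_add // nhits_small.
rewrite /nhits.
case: (pickP (fun j => j \notin [set j | [exists d in Q :|: E, hits w x j d]])).
  move=> j; rewrite inE => /exists_inPn hj;  exists j => d.
  rewrite -setUA inE => /orP[dp|/hj //].
  by rewrite ptrs_hits.
move=> all; rewrite (_ : [set j | _] = setT) ?cardsT ?card_ord ?ltnn //.
by apply/setP => j; rewrite in_setT; apply/negbFE/all.
Qed.

(* Reading the parity at [x] through its private share [c x] shows that the
   parities in [W] together with the other cells of [W] are uniform. *)
Lemma card_encode_agree v (W : {set 'I_N}) : ptrs \subset W ->
    (forall x, x \in W :&: main ->
       exists j, forall d, d \in W -> ~~ hits v x j d) ->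
  #|[set w | agree W (encode w) v]| = (n ^ (N - #|W|))%N.
Proof.
move=> ptW priv; set Y := W :&: main in priv *.
have [c cP] : exists c : 'I_N -> 'I_N, forall x, x \in Y ->
    exists j, c x = share j (loc v j x) /\ forall d, d \in W -> ~~ hits v x j d.
  apply: (fin_all_exists (P := fun x y => x \in Y ->
    exists j, y = share j (loc v j x) /\ forall d, d \in W -> ~~ hits v x j d)).
  move=> x; have [xY|xY] := boolP (x \in Y); last by exists x.
  by have [j hj] := priv _ xY; exists (share j (loc v j x)) => _; exists j.
have cW x : x \in Y -> c x \notin W.
  move=> xY; have [j [cx hj]] := cP _ xY; apply/negP => /hj.
  by rewrite /hits cx eqxx.
have c_loc x y j : x \in Y -> y \in Y -> c x = share j (loc v j y) -> x = y.
  move=> xY; have [j' [-> hj']] := cP _ xY.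
  rewrite inE => /andP[yW ym] /share_inj[<- e].
  have := hj' _ yW; rewrite /hits ym e eqxx andbT negb_or => /andP[_].
  by rewrite negbK => /eqP.
have c_inj : {in Y &, injective c}.
  move=> x y xY yY e; have [j [cy _]] := cP _ yY.
  by apply: (c_loc _ _ j xY yY); rewrite e.
pose owner i := [pick x in Y | c x == i].
have ownerc x : x \in Y -> owner (c x) = Some x.
  rewrite /owner => xY; case: pickP => [y /andP[yY /eqP /c_inj ->] //|].
  by move/(_ x); rewrite xY eqxx.
have ownerN i : i \notin c @: Y -> owner i = None.
  rewrite /owner => iY; case: pickP => // y /andP[yY /eqP e].
  by rewrite -e imset_f in iY.
pose Psi (w : word n N) : word n N := [ffun i =>
  if owner i is Some x then \sum_j w (share j (loc v j x)) else w i].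
pose u : word n N := [ffun i => if owner i is Some x then v x else v i].
pose K := W :\: main.
have Kc i : i \in K -> i \notin c @: Y.
  rewrite inE => /andP[_ iW]; apply/negP => /imsetP[x xY e].
  by have := cW _ xY; rewrite -e iW.
have Psi_inj : injective Psi.
  move=> w w' /ffunP e.
  have off i : i \notin c @: Y -> w i = w' i.
    by move=> iY; have := e i; rewrite !ffunE ownerN.
  apply/ffunP => i; have [/imsetP[x xY ->]|/off //] := boolP (i \in c @: Y).
  have := e (c x); rewrite !ffunE ownerc //.
  have [j [cx _]] := cP _ xY.
  rewrite cx (bigD1 j) //= [RHS](bigD1 j) //= (eq_bigr (fun j' =>
      w' (share j' (loc v j' x)))) => [/addIr //|j' jj'].
  apply: off; apply/imsetP => -[y yY ey].
  have yx : y = x by apply: (c_loc _ _ j').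
  by move: ey; rewrite yx cx => /share_inj[e' _]; rewrite e' eqxx in jj'.
have -> : [set w | agree W (encode w) v] =
    Psi @^-1: [set w | agree (K :|: c @: Y) w u].
  apply/setP => w; rewrite !inE.
  have par x : agree K w v -> x \in Y ->
      encode w x = \sum_j w (share j (loc v j x)).
    rewrite inE => wv /andP[_ xm]; rewrite ffunE xm; apply: eq_bigr => j _.
    rewrite (@loc_ptrs w v) //; apply: agreeS wv; apply/subsetP => i ip.
    by rewrite inE (subsetP ptW) // andbT; apply: contraL ip => /main_ptrs.
  have out i : i \in K -> encode w i = w i.
    by rewrite inE ffunE => /andP[/negbTE ->].
  have PsiK i : i \in K -> Psi w i = w i by move=> /Kc iK; rewrite ffunE ownerN.
  have uK i : i \in K -> u i = v i by move=> /Kc iK; rewrite ffunE ownerN.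
  apply/agreeP/agreeP => h.
    have wv : agree K w v.
      by apply/agreeP => i iK; rewrite -out // h //; move: iK; rewrite inE => /andP[].
    move=> i; rewrite inE => /orP[iK|/imsetP[x xY ->]].
      by rewrite PsiK // uK // (agreeP _ _ _ wv).
    rewrite !ffunE ownerc // -par // h //.
    by move: xY; rewrite inE => /andP[].
  have wv : agree K w v.
    by apply/agreeP => i iK; rewrite -PsiK // h ?uK // inE iK.
  move=> i iW; have [im|im] := boolP (i \in main).
    have iY : i \in Y by rewrite inE iW.
    have : Psi w (c i) = u (c i) by apply: h; rewrite inE imset_f ?orbT.
    by rewrite par // !ffunE ownerc.
  have iK : i \in K by rewrite inE im.
  by rewrite out // (agreeP _ _ _ wv).
rewrite card_preimset // card_agree cardsU disjoint_setI0; last first.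
  by rewrite disjoint_sym; apply/pred0P => i /=; apply/negP => /andP[+ /Kc /negP].
rewrite cards0 subn0 card_in_imset // addnC /K.
by rewrite /Y cardsID.
Qed.


Lemma card_residue x (s : 'I_V) :
  (#|[set p : 'I_n * 'I_n | inZp (p.1 * n + p.2 + x) == s]| <= (n * n) %/ V + 1)%N.
Proof.
set A := [set p | _].
pose f (p : 'I_n * 'I_n) : 'I_((n * n) %/ V).+1 := inord ((p.1 * n + p.2) %/ V).
have fE p : f p = ((p.1 * n + p.2) %/ V)%N :> nat.
  rewrite inordK // ltnS leq_div2r //.
  apply: (@leq_trans (n' * n + n)).
    by rewrite leq_add ?leq_mul2r ?leq_ord ?orbT // ltnW.
  by rewrite -mulSnr.
have f_inj : {in A &, injective f}.
  move=> p q; rewrite !inE => /eqP <- /eqP e /(congr1 val) /= /eqP.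
  rewrite !fE => /eqP ed; move/(congr1 val): e => /= /eqP.
  rewrite eqn_modDr => /eqP em.
  have {ed em} e : (p.1 * n + p.2 = q.1 * n + q.2)%N.
    by rewrite (divn_eq (p.1 * n + p.2) V) ed -em -divn_eq.
  have e1 : p.1 = q.1 :> nat.
    by have := congr1 (divn ^~ n) e; rewrite !divnMDl // !divn_small ?addn0.
  have e2 : p.2 = q.2 :> nat.
    by have := congr1 (modn ^~ n) e; rewrite !modnMDl !modn_small.
  by case: p q e1 e2 {e} => [? ?] [? ?] /= /val_inj -> /val_inj ->.
rewrite -(card_in_imset f_inj) addn1 -[leqRHS]card_ord.
exact: max_card.
Qed.

Definition block_ptrs x : {set 'I_N} :=
  [set ptr p.1 (blk x) p.2 | p in [set: 'I_T * bool]].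

Lemma card_block_ptrs x : #|block_ptrs x| = (T * 2)%N.
Proof.
rewrite card_imset ?cardsT ?card_prod ?card_ord ?card_bool //.
by move=> [j e] [j' e'] /cell_inj [-> ->].
Qed.

Lemma card_many_hits x D t : (t <= T)%N ->
  (#|[set w | t <= nhits w x D]| * (n * n) ^ t <=
     n ^ N * (T * (#|D| * ((n * n) %/ V + 1))) ^ t)%N.
Proof.
move=> tT; set E := [set w | _]; set a := ((n * n) %/ V + 1)%N.
have fiber v : (#|[set w in E | agree (~: block_ptrs x) w v]| <=
    T ^ t * ((#|D| * a) ^ t * #|{: 'I_n * 'I_n}| ^ (T - t)))%N.
  pose sg j d : 'I_V := if [pick s | share j s == d] is Some s then s else loc v j d.
  pose A j : {set 'I_n * 'I_n} :=
    [set p : 'I_n * 'I_n | [exists d in D, inZp (p.1 * n + p.2 + x) == sg j d]].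
  have Aa j : (#|A j| <= #|D| * a)%N.
    apply: (@leq_trans #|\bigcup_(d in D)
        [set p : 'I_n * 'I_n | inZp (p.1 * n + p.2 + x) == sg j d]|).
      apply/subset_leq_card/subsetP => p; rewrite inE => /exists_inP[d dD e].
      by apply/bigcupP; exists d; rewrite ?inE.
    apply: leq_trans (leq_card_bigcup _ _) _.
    by rewrite -sum_nat_const leq_sum // => d _; apply: card_residue.
  apply: leq_trans (card_ffun_many_hits tT Aa).
  pose y (w : word n N) : {ffun 'I_T -> 'I_n * 'I_n} :=
    [ffun j => (w (ptr j (blk x) false), w (ptr j (blk x) true))].
  have y_inj : {in [set w in E | agree (~: block_ptrs x) w v] &, injective y}.
    move=> w w'; rewrite !inE => /andP[_ /agreeP h] /andP[_ /agreeP h'] /ffunP e.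
    apply/ffunP => i; have [ib|ib] := boolP (i \in block_ptrs x).
      case/imsetP: ib => -[j b] _ ->; have := e j; rewrite !ffunE => -[e1 e2].
      by case: b.
    by rewrite h ?h' // inE.
  rewrite -(card_in_imset y_inj); apply/subset_leq_card/subsetP => _ /imsetP[w + ->].
  rewrite !inE => /andP[tw /agreeP wv]; apply: leq_trans tw _.
  apply/subset_leq_card/subsetP => j; rewrite !inE => /exists_inP[d dD hd].
  apply/exists_inP; exists d => //; rewrite ffunE /=.
  rewrite -[inZp _]/(loc w j x) /sg; case: pickP => [s /eqP sd|ns].
    case/orP: hd => [|/andP[]]; last by rewrite -sd cell_main.
    by rewrite -sd => /eqP /share_inj[_ ->].
  case/orP: hd => [/eqP e|/and3P[_ dx /eqP e]].
    by have := ns (loc w j x); rewrite e eqxx.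
  rewrite -e /loc /shift !wv //.
    rewrite inE; apply/imsetP => -[[j' b] _ /cell_inj [_ eb _]].
    by move/eqP: dx; apply; apply: loc_same_block e.
  rewrite inE; apply/imsetP => -[[j' b] _ /cell_inj [_ eb _]].
  by move/eqP: dx; apply; apply: loc_same_block e.
have := card_resample fiber; rewrite card_block_ptrs card_prod card_ord.
have nn : (n ^ (T * 2) = (n * n) ^ t * (n * n) ^ (T - t))%N.
  by rewrite -expnD subnKC // mulnC expnM mulnn.
rewrite nn !mulnA leq_pmul2r ?expn_gt0 ?muln_gt0 //.
by rewrite -!mulnA -expnMn.
Qed.

Lemma card_not_good Q t q : (t < T)%N -> (0 < q)%N -> (#|Q| <= q)%N ->
  (#|[set w | ~~ good t Q w]| * (n * n) ^ t.+1 <=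
     N * N.+1 * (n ^ N * (T * (q * ((n * n) %/ V + 1))) ^ t.+1))%N.
Proof.
move=> tT q0 Qq.
pose S : {set 'I_N * option 'I_N} := setT.
pose D (o : option 'I_N) := if o is Some e then [set e] else Q.
have Dq o : (#|D o| <= q)%N by case: o => //= e; rewrite cards1.
apply: (@leq_trans (\sum_(p in S)
    #|[set w | (t < nhits w p.1 (D p.2))%N]| * (n * n) ^ t.+1)).
  rewrite -big_distrl leq_mul2r; apply/orP; right.
  apply: leq_trans (leq_card_bigcup _ _).
  apply/subset_leq_card/subsetP => w; rewrite inE => /forall_inPn[x xm].
  rewrite negb_and -ltnNge => /orP[h|/forallPn[e]].
    by apply/bigcupP; exists (x, None); rewrite ?in_setT ?inE.
  by rewrite -ltnNge => h; apply/bigcupP; exists (x, Some e); rewrite ?in_setT ?inE.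
have -> : (N * N.+1 = #|S|)%N by rewrite cardsT card_prod card_option card_ord.
rewrite -sum_nat_const; apply: leq_sum => -[x o] _ /=.
apply: leq_trans (card_many_hits x (D o) tT) _.
by rewrite leq_mul2l leq_exp2r // !leq_mul ?orbT.
Qed.

Lemma card_codewords : (#|codewords| <= n ^ #|aux|)%N.
Proof.
pose f w : {ffun aux -> 'I_n} := [ffun a => w (cell a)].
have f_inj : {in codewords &, injective f}.
  move=> w w'; rewrite !inE => /eqP cw /eqP cw' /ffunP e.
  have ce a : w (cell a) = w' (cell a) by have := e a; rewrite !ffunE.
  rewrite -cw -cw'; apply/ffunP => x; rewrite !ffunE; case: ifP => [_|].
    apply: eq_bigr => j _; rewrite (@loc_ptrs w w') ?ce //.
    by apply/agreeP => i /imsetP[p _ ->].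
  by rewrite inE => /negbFE /codomP[a ->].
rewrite -(card_in_imset f_inj); apply: leq_trans (max_card _) _.
by rewrite card_ffun card_ord.
Qed.

Lemma card_ball v e :
  (#|[set w : word n N | #|[set i | v i != w i]| <= e]| <= 2 ^ N * n ^ e)%N.
Proof.
apply: (@leq_trans #|\bigcup_(D : {set 'I_N} | (#|D| <= e)%N)
    [set w | agree (~: D) w v]|).
  apply/subset_leq_card/subsetP => w; rewrite inE => h; apply/bigcupP.
  exists [set i | v i != w i] => //; rewrite inE; apply/agreeP => i.
  by rewrite !inE negbK => /eqP.
apply: leq_trans (leq_card_bigcup _ _) _.
apply: (@leq_trans (\sum_(D : {set 'I_N} | (#|D| <= e)%N) n ^ e)).
  apply: leq_sum => D De; rewrite card_agree.
  by rewrite card_setCN subKn ?card_le_ord // leq_pexp2l.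
rewrite sum_nat_const leq_mul2r; apply/orP; right.
have e2 : #|powerset [set: 'I_N]| = (2 ^ N)%N by rewrite card_powerset cardsT card_ord.
by rewrite -e2 powersetT cardsT max_card.
Qed.

Lemma card_near_codewords e :
  (#|[set w : word n N | [exists v in codewords, #|[set i | v i != w i]| <= e]]| <=
     n ^ #|aux| * (2 ^ N * n ^ e))%N.
Proof.
apply: (@leq_trans #|\bigcup_(v in codewords)
    [set w : word n N | (#|[set i | v i != w i]| <= e)%N]|).
  apply/subset_leq_card/subsetP => w; rewrite inE => /exists_inP[v cv h].
  by apply/bigcupP; exists v => //; rewrite inE.
apply: leq_trans (leq_card_bigcup _ _) _.
apply: (@leq_trans (\sum_(v in codewords) 2 ^ N * n ^ e)).
  by apply: leq_sum => v _; apply: card_ball.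
by rewrite sum_nat_const leq_mul2r card_codewords orbT.
Qed.

Section TailAdaptive.
Variables (R : realType) (A : algorithm R n N) (c : coins A) (k t : nat).
Hypothesis kt : (k.+1 * t < T)%N.
Hypothesis single : forall w l, (1 <= l <= k)%N -> #|queries w c l| = 1%N.

Lemma card_accepts_encode :
  (#|[set w | accepts k (encode w) c]| <=
     #|[set w | accepts k w c]| + #|[set w | ~~ good t (ask c [::]) w]|)%N.
Proof.
set Q := ask c [::].
pose E w := \bigcup_(l < k) queries w c l.+1.
pose W w := ptrs :|: Q :|: E w.
have Ek w : (#|E w| <= k)%N.
  apply: leq_trans (leq_card_bigcup _ _) _.
  rewrite (eq_bigr (fun=> 1%N)) ?sum1_card ?card_ord // => l _.
  by rewrite single //= ltn_ord.
have transW w v l : agree (W w) v w -> (l <= k.+1)%N ->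
    transcript v c l = transcript w c l.
  move=> vw; elim: l => // l IH lk /=; rewrite IH ?(ltnW lk) //.
  congr rcons; apply/ffunP => i; rewrite !ffunE; case: ifP => // il.
  congr Some; apply: (agreeP _ _ _ vw).
  rewrite /W -setUA inE; apply/orP; right; rewrite inE; apply/orP.
  case: l IH lk il => [|l] IH lk il; [by left|right].
  by apply/bigcupP; exists (Ordinal (lk : (l < k)%N)).
have ptW w : ptrs \subset W w by rewrite /W -setUA subsetUl.
have same w v : agree (W w) v w -> [/\ W v = W w,
    accepts k v c = accepts k w c & good t Q v = good t Q w].
  move=> vw; split.
  - rewrite /W; congr (_ :|: _); apply: eq_bigr => l _.
    by rewrite /queries (transW w) // ltnW // ltnS.
  - by rewrite /accepts (transW w).
  - by apply: good_ptrs; apply: agreeS vw.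
have := card_transfer (ltn0Sn n') same (fun w => good_ptrs t Q (encode_ptrs w)).
have unif v : good t Q v ->
    #|[set w | agree (W v) (encode w) v]| = (n ^ (N - #|W v|))%N.
  move=> gv; apply: card_encode_agree => // x; rewrite inE => /andP[_ xm].
  apply: (good_private gv xm); apply: leq_ltn_trans kt.
  by rewrite leq_mul2r ltnS Ek orbT.
move=> /(_ unif) e.
set X := [set w | good t Q w && accepts k w c] in e.
apply: (@leq_trans (#|X| + #|[set w | ~~ good t Q w]|)).
  rewrite -e; apply: leq_trans (leq_card_setU _ _).1.
  apply/subset_leq_card/subsetP => w; rewrite !inE => ->.
  by case: (good t Q w).
rewrite leq_add2r; apply/subset_leq_card/subsetP => w.
by rewrite !inE => /andP[].
Qed.

End TailAdaptive.

Lemma tail_adaptive_error (R : realType) (eps delta eta : R) (A : algorithm R n N)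
    (q k t : nat) :
    (0 < N)%N -> 0 <= eps -> (k.+1 * t < T)%N -> (q <= n)%N ->
    (N * N.+1 * (T * (n * ((n * n) %/ V + 1))) ^ t.+1)%:R
      <= eta * ((n * n) ^ t.+1)%:R ->
    (n ^ #|aux| * (2 ^ N * n ^ Num.truncn (eps * N%:R)))%:R <= eta * (n ^ N)%:R ->
  tail_adaptive_tester k q codewords eps delta A -> 1 - delta <= delta + eta *+ 2.
Proof.
move=> N0 eps0 kt qn bad near [shape [yes no]].
have N0R : 0 < N%:R :> R by rewrite ltr0n.
pose S : R := #|{: word n N}|%:R.
have S0 : 0 < S by rewrite ltr0n card_word expn_gt0.
have single (c : coins A) w l : (1 <= l <= k)%N -> #|queries w c l| = 1%N.
  by have [h _] := shape w c; apply: h.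
have Qn (c : coins A) : (#|ask c [::]| <= n)%N.
  have [_ h] := shape (encode [ffun=> 0]) c.
  by apply: leq_trans qn; rewrite -h leq_addr.
have tT : (t < T)%N by apply: leq_ltn_trans kt; rewrite leq_pmull.
have sumPr (f : word n N -> word n N) : \sum_w Pr_accept A k (f w) =
    \sum_(c : coins A) prob c * #|[set w | accepts k (f w) c]|%:R.
  rewrite /Pr_accept; under eq_bigr do rewrite big_mkcond.
  rewrite exchange_big /=; apply: eq_bigr => c _.
  rewrite -big_mkcond /= sumr_const mulr_natr; congr (_ *+ _).
  by apply: eq_card => w; rewrite inE.
have Pr1 := Pr_acceptD A k.
have rej0 w : 0 <= Pr_reject A k w by apply: sumr_ge0 => c _; apply: prob_ge0.
set near_set := [set w : word n N | [exists v in codewords,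
  #|[set i | v i != w i]| <= Num.truncn (eps * N%:R)]%N].
have nearS : #|near_set|%:R <= eta * S.
  by rewrite /S card_word; apply: le_trans near; rewrite ler_nat card_near_codewords.
have badS (c : coins A) : #|[set w | ~~ good t (ask c [::]) w]|%:R <= eta * S.
  have := card_not_good tT (ltn0Sn n') (Qn c).
  rewrite -(ler_nat R) natrM mulnCA natrM => h.
  have nn0 : 0 < ((n * n) ^ t.+1)%:R :> R by rewrite ltr0n expn_gt0.
  rewrite -(ler_pM2r nn0); apply: le_trans h _.
  by rewrite /S card_word mulrAC mulrC ler_wpM2r // ler0n.
clear bad near.
have lo : S * (1 - delta) <= \sum_w Pr_accept A k (encode w).
  rewrite /S mulr_natl -sumr_const; apply: ler_sum => w _.
  exact/yes/encode_codewords.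
have mid : \sum_w Pr_accept A k (encode w) <= \sum_w Pr_accept A k w + eta * S.
  rewrite (sumPr encode) (sumPr id).
  rewrite -[eta * S]mul1r -[X in X * (eta * S)](prob_sum1 A) mulr_suml.
  rewrite -big_split /=; apply: ler_sum => c _; rewrite -mulrDr.
  apply: ler_wpM2l; first exact: prob_ge0.
  apply: (@le_trans _ _ (#|[set w | accepts k w c]| +
    #|[set w | ~~ good t (ask c [::]) w]|)%:R).
    by rewrite ler_nat card_accepts_encode // => w l; apply: single.
  by rewrite natrD lerD2l badS.
have hi : \sum_w Pr_accept A k w <= delta * S + eta * S.
  have : \sum_w Pr_accept A k w <= \sum_w (delta + (w \in near_set)%:R).
    apply: ler_sum => w _; have := Pr1 w; have := rej0 w.
    have [wn|wn] := boolP (w \in near_set).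
      have d0 : 0 <= delta.
        have := yes _ (encode_codewords w); have := Pr1 (encode w).
        have := rej0 (encode w); lra.
      by rewrite mulr1n; lra.
    have := no w; have : far codewords eps w.
      move=> v vc; rewrite /reldist ltr_pdivlMr // ltNge; apply/negP => h.
      move: wn; rewrite inE => /exists_inP; apply; exists v => //.
      by rewrite truncn_ge_nat // mulr_ge0 // ltW.
    by move=> fw /(_ fw); rewrite mulr0n; lra.
  move/le_trans; apply; rewrite big_split /= sumr_const mulr_natr lerD2l.
  have -> : \sum_w (w \in near_set)%:R = #|near_set|%:R :> R.
    rewrite -sum1_card natr_sum [RHS]big_mkcond; apply: eq_bigr => w _.
    by case: (w \in near_set).
  exact: nearS.
rewrite -(ler_pM2l S0) mulr2n; lra.
Qed.

Definition word_of (h : answers n N) : word n N := [ffun i => odflt ord0 (h i)].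

Lemma word_of_reply w Q : agree Q (word_of (reply w Q)) w.
Proof. by apply/agreeP => i iQ; rewrite !ffunE iQ. Qed.

Definition pad s Q : {set 'I_N} :=
  if [pick C : {set 'I_N} | (Q \subset C) && (#|C| == s)] is Some C then C else Q.

Lemma padP s Q : (#|Q| <= s <= N)%N -> Q \subset pad s Q /\ #|pad s Q| = s.
Proof.
move=> h; rewrite /pad; case: pickP => [C /andP[QC /eqP] //|none].
have [|C [QC _ Cs]] := @exists_set_between _ Q setT s (subsetT Q).
  by rewrite cardsT card_ord.
by have := none C; rewrite QC Cs eqxx.
Qed.

Section Tester.
Variables (R : realType) (r q k' : nat).
Local Notation k := k'.+1.
Hypotheses (N0 : (0 < N)%N) (qE : q = (r * (1 + 3 * T))%N) (qN : (q <= N)%N).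

Definition sample : finType := {ffun 'I_r -> 'I_N}.
Implicit Types c : sample.

Definition probe0 c : {set 'I_N} := [set c i | i in 'I_r] :|:
  [set ptr p.1.2 (blk (c p.1.1)) p.2 | p in [set: 'I_r * 'I_T * bool]].

Definition probe1 c w : {set 'I_N} :=
  [set share p.2 (loc w p.2 (c p.1)) | p in [set: 'I_r * 'I_T]].

Definition tester_ask c (h : seq (answers n N)) : {set 'I_N} :=
  match h with
  | [::] => probe0 c
  | [:: a] => pad (q - #|probe0 c|)%N (probe1 c (word_of a))
  | _ => set0
  end.

Definition tester_verdict c (h : seq (answers n N)) : bool :=
  match h with
  | [:: a0, a1 & _] => [forall i, (c i \in main) ==> (word_of a0 (c i) ==
      \sum_j word_of a1 (share j (loc (word_of a0) j (c i))))]
  | _ => false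
  end.

Fact uniform_ge0 c : 0 <= #|sample|%:R^-1 :> R.
Proof. by rewrite invr_ge0 ler0n. Qed.

Lemma card_sample : #|sample| = (N ^ r)%N.
Proof. by rewrite card_ffun !card_ord. Qed.

Fact uniform_sum1 : \sum_(c : sample) #|sample|%:R^-1 = 1 :> R.
Proof.
by rewrite sumr_const -[LHS]mulr_natr mulVf // card_sample pnatr_eq0 -lt0n expn_gt0 N0.
Qed.

Definition tester : algorithm R n N :=
  Algorithm uniform_ge0 uniform_sum1 tester_ask tester_verdict.

Lemma card_probe0 c : (#|probe0 c| <= r * (1 + 2 * T))%N.
Proof.
rewrite mulnDr muln1; apply: leq_trans (leq_card_setU _ _).1 _.
rewrite leq_add ?(leq_trans (leq_imset_card _ _)) ?card_ord //.
by rewrite cardsT !card_prod !card_ord card_bool mulnAC mulnA.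
Qed.

Lemma card_probe1 c w : (#|probe1 c w| <= r * T)%N.
Proof.
apply: leq_trans (leq_imset_card _ _) _.
by rewrite cardsT card_prod !card_ord.
Qed.

Lemma probe_pad c w : (#|probe1 c w| <= q - #|probe0 c| <= N)%N.
Proof.
rewrite (leq_trans (leq_subr _ _) qN) andbT qE.
apply: leq_trans (card_probe1 c w) _.
rewrite leq_subRL.
  by rewrite (leq_trans (leq_add (card_probe0 c) (leqnn _))) // -mulnDr -addnA -mulSnr.
by rewrite (leq_trans (card_probe0 c)) // leq_mul2l leq_add2l leq_mul2r !orbT.
Qed.

Definition answer0 w c := reply w (probe0 c).
Definition answer1 w c :=
  reply w (pad (q - #|probe0 c|)%N (probe1 c (word_of (answer0 w c)))).

Lemma tester_transcript w c l : exists s,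
  transcript (T := tester) w c l.+2 = [:: answer0 w c, answer1 w c & s].
Proof.
elim: l => [|l [s IH]]; first by exists [::].
have -> : transcript (T := tester) w c l.+3 =
  rcons (transcript (T := tester) w c l.+2)
    (reply w (tester_ask c (transcript (T := tester) w c l.+2))) by [].
by rewrite IH !rcons_cons; eexists.
Qed.

Lemma tester_queries w c :
  (\sum_(l < k.+1) #|queries (T := tester) w c l|)%N = q.
Proof.
rewrite big_ord_recl big_ord_recl big1 => [|l _]; last first.
  by have [s e] := tester_transcript w c l;
    rewrite -[nat_of_ord (lift _ _)]/(l.+2) /queries e /= cards0.
rewrite addn0 /queries /=.
have [_ ->] := padP (probe_pad c (word_of (answer0 w c))).
rewrite subnKC // qE (leq_trans (card_probe0 c)) //.
by rewrite leq_mul2l leq_add2l leq_mul2r !orbT.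
Qed.

Lemma tester_accepts w c :
  accepts (T := tester) k w c = [forall i, encode w (c i) == w (c i)].
Proof.
have [s e] := tester_transcript w c k'; rewrite /accepts e /=.
have a0 := agreeP _ _ _ (word_of_reply w (probe0 c)).
have eloc i j : loc (word_of (answer0 w c)) j (c i) = loc w j (c i).
  have pt b : ptr j (blk (c i)) b \in probe0 c.
    rewrite inE; apply/orP; right; apply/imsetP.
    by exists (i, j, b); rewrite ?in_setT.
  by rewrite /loc /shift !a0.
apply: eq_forallb => i; rewrite [encode w _]ffunE; case: ifP => im /=; last first.
  by rewrite eqxx.
rewrite eq_sym a0 ?inE ?imset_f //; congr (_ == _).
apply: eq_bigr => j _; rewrite eloc.
have [/subsetP sub _] := padP (probe_pad c (word_of (answer0 w c))).
rewrite (agreeP _ _ _ (word_of_reply w _)) // sub //.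
by apply/imsetP; exists (i, j); rewrite ?in_setT ?eloc.
Qed.

Lemma tester_one_sided : one_sided tester k codewords.
Proof.
move=> w; rewrite inE => /eqP cw; rewrite /Pr_accept -[RHS](prob_sum1 tester).
by apply: eq_bigl => c; rewrite tester_accepts cw; apply/forallP.
Qed.

Lemma tester_Pr_accept w : Pr_accept tester k w =
  (#|[set x | encode w x == w x]|%:R / N%:R) ^+ r.
Proof.
rewrite /Pr_accept sumr_const /= card_sample expr_div_n -!natrX -[LHS]mulr_natl.
congr (_ %:R * _); rewrite -[in RHS](card_ord r) -card_ffun_on.
apply: eq_card => c; rewrite -[LHS]/(accepts (T := tester) k w c) tester_accepts.
by apply/forallP/ffun_onP => h i; move: (h i); rewrite inE.
Qed.

Lemma tester_tests (eps : R) : 0 < eps <= 1 -> 2 <= eps * r%:R ->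
  tests tester k codewords eps 3^-1.
Proof.
move=> /andP[e0 e1] er; split=> w.
  by move=> /tester_one_sided ->; rewrite gerBl invr_ge0 ler0n.
move=> wfar; have -> : Pr_reject tester k w = 1 - Pr_accept tester k w.
  by rewrite -(Pr_acceptD tester k w) addrAC subrr add0r.
rewrite lerD2l lerN2 tester_Pr_accept.
set g := _ / _.
have g0 : 0 <= g by rewrite divr_ge0.
have ge : g <= 1 - eps.
  have := wfar _ (encode_codewords w); rewrite /reldist => /ltW h.
  rewrite lerBrDl -lerBrDr; apply: le_trans h _.
  rewrite ler_pdivrMr ?ltr0n // mulrBl mul1r divfK ?pnatr_eq0 -?lt0n //.
  rewrite lerBrDr -natrD ler_nat -[leqRHS]card_ord.
  rewrite -[leqRHS](cardsC [set x | encode w x == w x]) addnC leq_add2l.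
  by apply/subset_leq_card/subsetP => x; rewrite !inE.
have ge1 : g * (1 + eps) <= 1 by nra.
have := exprn_ile1 r _ ge1; rewrite exprMn mulr_ge0 ?addr_ge0 ?(ltW e0) // => /(_ isT) h.
have B : 3 <= (1 + eps) ^+ r.
  apply: (@le_trans _ _ (1 + eps *+ r)); last exact/bernoulli_ineq/ltW.
  by rewrite -mulr_natr; lra.
have gr0 : 0 <= g ^+ r by rewrite exprn_ge0.
by rewrite -[3^-1]mul1r ler_pdivlMr //; apply: le_trans h; rewrite ler_wpM2l.
Qed.

End Tester.

Lemma codewords_tester (R : realType) (eps : R) (r k : nat) :
    (0 < N)%N -> 0 < eps <= 1 -> 2 <= eps * r%:R ->
  exists (q : nat) (A : algorithm R n N),
    [/\ round_adaptive_tester k q codewords eps A, one_sided A k codewords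
      & (0 < k)%N -> (q <= r * (1 + 3 * T))%N].
Proof.
move=> N0 e01 er; have /andP[e0 _] := e01.
have all v w : agree setT v w -> v \in codewords -> w \in codewords.
  by move=> /agreeP vw; have -> : v = w by apply/ffunP => i; apply: vw.
have [full os] := one_round_tester all k e0.
have [qN|Nq] := leqP (r * (1 + 3 * T)) N; last first.
  exists #|[set: 'I_N]|, (one_round R codewords setT); split=> // _.
  by rewrite cardsT card_ord ltnW.
case: k full os => [|k] full os.
  by exists #|[set: 'I_N]|, (one_round R codewords setT).
exists (r * (1 + 3 * T))%N, (tester R r (r * (1 + 3 * T)) N0); split=> //.
  by split; [move=> w c; apply: tester_queries | apply: tester_tests].
exact: tester_one_sided.
Qed.

End Construction.

(** * Asymptotics *)

Section Asymptotics.
Variables (R : realType) (alpha : R).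

(* Makes [(n^(alpha/4))^(max_hits + 1)] at least [n^5], which absorbs the union
   bound over the [N (N + 1) = O(n^4)] pairs of a main cell and a query set. *)
Definition max_hits : nat := (Num.truncn (20 / alpha)).+1.
Definition table_count (k : nat) : nat := (k.+1 * max_hits).+1.
Definition table_size (n : nat) : nat := Num.truncn (n%:R `^ (1 + alpha / 2) : R).
Definition block_count (n : nat) : nat := (block_length alpha n %/ (table_size n).+1)%N.

Variables n k : nat.
Hypotheses (alpha01 : 0 < alpha < 1) (n_ge1 : 1 <= n%:R :> R)
  (kn : k%:R <= n%:R `^ (alpha / 4)).

Local Notation N := (block_length alpha n).
Local Notation V := (table_size n).+1.
Local Notation T := (table_count k).
Local Notation t := (max_hits%:R).
Local Notation y := (n%:R `^ (alpha / 4)).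
Local Notation nR := (n%:R).

Lemma max_hits_ge1 : 1 <= t :> R.
Proof. by rewrite ler1n. Qed.

Lemma powR_mono (b c : R) : b <= c -> nR `^ b <= nR `^ c.
Proof. exact: ler_powR. Qed.

Lemma y_ge1 : 1 <= y.
Proof.
have /andP[a0 a1] := alpha01.
by rewrite -[leLHS](powRr0 n%:R); apply: powR_mono; lra.
Qed.

Lemma expr_y (i : nat) : y ^+ i = nR `^ (alpha / 4 * i%:R).
Proof. by rewrite -powR_mulrn ?powR_ge0 // -powRrM. Qed.

Lemma powR_ny (i : nat) (b : R) : b = alpha / 4 * i%:R -> nR `^ (1 + b) = nR * y ^+ i.
Proof. move=> ->; rewrite powRD ?powRr1 ?ler0n ?expr_y //.
by apply/implyP => _; rewrite lt0r_neq0 // (lt_le_trans ltr01). Qed.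

Lemma y4_le : y ^+ 4 <= nR.
Proof.
have /andP[a0 a1] := alpha01.
by rewrite expr_y -[leRHS](powRr1 (ler0n _ n)); apply: powR_mono; lra.
Qed.

Lemma y_large : nR ^+ 5 <= y ^+ max_hits.+1.
Proof.
have /andP[a0 a1] := alpha01.
rewrite expr_y -powR_mulrn ?ler0n //; apply: powR_mono.
have h : 20 / alpha < t by rewrite /max_hits truncnS_gt.
have {h} : 20 < t * alpha by rewrite -ltr_pdivrMr //; lra.
by rewrite -natr1; lra.
Qed.

Lemma N_bounds : nR * y ^+ 4 <= N%:R *+ 2 /\ (N <= n * n)%N.
Proof.
have /andP[a0 a1] := alpha01; have n1 := n_ge1.
have e : nR `^ (1 + alpha) = nR * y ^+ 4 by apply: powR_ny; lra.
have y4 : 1 <= y ^+ 4 by rewrite exprn_ege1 // y_ge1.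
have ny : 1 <= nR * y ^+ 4 by rewrite mulr_ege1.
split.
  have := truncnS_gt (nR `^ (1 + alpha) + 2^-1); rewrite -[N.+1%:R]natr1 e; lra.
rewrite -ltnS -(ltr_nat R) -natr1 natrM.
apply: (@le_lt_trans _ _ (nR `^ (1 + alpha) + 2^-1)).
  by rewrite truncn_le addr_ge0 ?powR_ge0 // invr_ge0.
have h : nR * y ^+ 4 <= nR * nR by rewrite ler_pM2l ?y4_le //; lra.
by rewrite e; lra.
Qed.

Lemma V_bounds : nR * y ^+ 2 <= V%:R /\ V%:R <= nR * y ^+ 2 *+ 2.
Proof.
have /andP[a0 a1] := alpha01; have n1 := n_ge1.
have e : nR `^ (1 + alpha / 2) = nR * y ^+ 2 by apply: powR_ny; lra.
have ny : 1 <= nR * y ^+ 2 by rewrite mulr_ege1 // exprn_ege1 // y_ge1.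
split; rewrite -e; first exact/ltW/truncnS_gt.
rewrite -natr1 mulr2n lerD //; first by rewrite truncn_le powR_ge0.
by rewrite e.
Qed.

Lemma T_bound : T%:R <= 3 * t * y.
Proof.
have /andP[a0 a1] := alpha01; have n1 := n_ge1.
have -> : T%:R = (k%:R + 1) * t + 1 :> R.
  by rewrite -[T%:R]natr1 natrM -[k.+1%:R]natr1.
have t1 := max_hits_ge1; have y1 := y_ge1; have kn' := kn.
have : k%:R * t <= y * t by rewrite ler_wpM2r //; lra.
have : t * 1 <= t * y by rewrite ler_wpM2l //; lra.
rewrite mulr1; lra.
Qed.

Lemma V_gt_n : (n < V)%N.
Proof.
have /andP[a0 a1] := alpha01; have n1 := n_ge1.
rewrite ltnS truncn_ge_nat ?powR_ge0 // -[leLHS](powRr1 (ler0n _ n)).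
by apply: powR_mono; lra.
Qed.

Lemma block_count_lt : (block_count n < V)%N.
Proof.
apply: leq_ltn_trans V_gt_n; rewrite /block_count.
apply: (@leq_trans ((n * n) %/ V)); first by rewrite leq_div2r // (proj2 N_bounds).
by rewrite -ltnS ltn_divLR //; have := V_gt_n; nia.
Qed.

Lemma N_le_blocks : (N <= (block_count n).+1 * V)%N.
Proof. by rewrite /block_count ltnW // ltn_ceil. Qed.

Lemma aux_bound :
  #|aux T (table_size n) (block_count n)|%:R * y <= 36 * t * N%:R.
Proof.
have /andP[a0 a1] := alpha01; have n1 := n_ge1.
have card : (#|aux T (table_size n) (block_count n)| <= 3 * (T * V))%N.
  rewrite card_sum !card_prod !card_ord card_bool mulnC.
  have : (T * (block_count n).+1 <= T * V)%N by rewrite leq_mul2l block_count_lt orbT.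
  lia.
have t1 := max_hits_ge1; have y1 := y_ge1.
have [VL VU] := V_bounds; have [NL _] := N_bounds.
apply: (@le_trans _ _ (3 * (3 * t * y * (nR * y ^+ 2 *+ 2)) * y)).
  rewrite ler_wpM2r //; first lra.
  apply: (@le_trans _ _ (3 * (T * V))%:R); first by rewrite ler_nat.
  by rewrite natrM natrM ler_wpM2l // ler_pM ?ler0n ?T_bound.
apply: (@le_trans _ _ (18 * t * (nR * y ^+ 4))); first by
  rewrite le_eqVlt; apply/predU1l; ring.
have -> : 36 * t * N%:R = 18 * t * (N%:R *+ 2) :> R by ring.
by rewrite ler_wpM2l //; lra.
Qed.

Lemma aux_small (e : R) : 36 * t <= e * y ->
  #|aux T (table_size n) (block_count n)|%:R <= e * N%:R.
Proof.
have /andP[a0 a1] := alpha01; have n1 := n_ge1.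
move=> h; have t1 := max_hits_ge1; have y1 := y_ge1.
have y0 : 0 < y by lra.
rewrite -(ler_pM2r y0); apply: le_trans aux_bound _.
by rewrite [leRHS]mulrAC ler_wpM2r ?ler0n.
Qed.

Lemma not_good_small (eta : R) : 0 < eta -> 2 * (6 * t) ^+ max_hits.+1 <= eta * nR ->
  (N * N.+1 * (T * (n * ((n * n) %/ V + 1))) ^ max_hits.+1)%:R
    <= eta * ((n * n) ^ max_hits.+1)%:R.
Proof.
have /andP[a0 a1] := alpha01; have n1 := n_ge1.
move=> eta0; have t1 := max_hits_ge1; have y1 := y_ge1.
have [VL VU] := V_bounds; have [_ NU] := N_bounds.
have y0 : 0 < y by lra.
have V0 : 0 < V%:R :> R by rewrite ltr0n.
set b := (T * (n * ((n * n) %/ V + 1)))%N.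
have ab : (((n * n) %/ V + 1)%N)%:R * y ^+ 2 <= nR *+ 2.
  rewrite natrD mulrDl mul1r mulr2n lerD //.
    have y20 : 0 < nR * y ^+ 2 by rewrite mulr_gt0 ?exprn_gt0 //; lra.
    have : ((n * n) %/ V * V)%:R <= (n * n)%:R :> R by rewrite ler_nat leq_divM.
    rewrite !natrM => hV.
    have hV' : ((n * n) %/ V)%:R * (nR * y ^+ 2) <= nR * nR.
      by apply: le_trans hV; rewrite ler_wpM2l.
    have nR0 : 0 < nR :> R by apply: lt_le_trans n1.
    by rewrite -(ler_pM2l nR0) mulrCA.
  by apply: le_trans y4_le; rewrite ler_weXn2l.
have by_ : b%:R * y <= 6 * t * (nR * nR).
  rewrite /b !natrM.
  apply: (@le_trans _ _ (3 * t * y * (nR * ((n * n) %/ V + 1)%:R) * y)).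
    rewrite ler_wpM2r ?(ltW y0) // ler_wpM2r ?T_bound // mulr_ge0 ?ler0n //.
  have -> : 3 * t * y * (nR * ((n * n) %/ V + 1)%:R) * y =
      3 * t * nR * (((n * n) %/ V + 1)%:R * y ^+ 2) by ring.
  have -> : 6 * t * (nR * nR) = 3 * t * nR * (nR *+ 2) :> R by ring.
  by rewrite ler_wpM2l // !mulr_ge0 //; lra.
have nR0 : 0 < nR :> R by apply: lt_le_trans n1.
have NN : (N * N.+1)%:R <= 2 * nR ^+ 4 :> R.
  apply: (@le_trans _ _ ((n * n) * (n * n * 2))%:R).
    have n0 : (0 < n)%N by rewrite -(ler1n R).
    by rewrite ler_nat leq_mul // muln2 -addnn -addn1 leq_add // muln_gt0 n0.
  by rewrite !natrM le_eqVlt; apply/predU1l; ring.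
have fin (p r : nat) (c : R) : p%:R * nR ^+ 5 <= c * r%:R -> 2 * c <= eta * nR ->
    (N * N.+1 * p)%:R <= eta * r%:R.
  move=> pr ce; rewrite -(ler_pM2r nR0) natrM.
  apply: (@le_trans _ _ (2 * (p%:R * nR ^+ 5))).
    have -> : 2 * (p%:R * nR ^+ 5) = 2 * nR ^+ 4 * p%:R * nR :> R by ring.
    by rewrite ler_wpM2r ?(ltW nR0) // ler_wpM2r ?ler0n.
  apply: (@le_trans _ _ (2 * (c * r%:R))); first by rewrite ler_wpM2l.
  by rewrite mulrA [leRHS]mulrAC ler_wpM2r ?ler0n.
move=> h; apply: fin h; rewrite !natrX natrM.
apply: (@le_trans _ _ ((b%:R * y) ^+ max_hits.+1)).
  by rewrite exprMn ler_wpM2l ?exprn_ge0 ?ler0n // y_large.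
rewrite -[leRHS]exprMn; apply: lerXn2r => //; rewrite nnegrE ?mulr_ge0 ?ler0n //.
exact: ltW.
Qed.

Lemma near_small (eps eta : R) (m s : nat) : 0 < eps < 1 -> 0 < eta ->
    (0 < N)%N -> m%:R <= (1 - eps) / 2 * N%:R ->
    4 <= (1 - eps) * s%:R -> (2 ^ s <= n)%N -> 2 <= eta * nR ->
  (n ^ m * (2 ^ N * n ^ Num.truncn (eps * N%:R)))%:R <= eta * (n ^ N)%:R.
Proof.
have /andP[a0 a1] := alpha01; have n1 := n_ge1.
move=> /andP[e0 e1] eta0 N0 hm hs ns hn.
set e := Num.truncn _.
have eN : e%:R <= eps * N%:R by rewrite truncn_le mulr_ge0 ?ler0n // ltW.
have meN : (m + e <= N)%N.
  have : 0 <= (1 - eps) * N%:R by rewrite mulr_ge0 ?ler0n //; lra.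
  by rewrite -(ler_nat R) natrD; lra.
have key : (2 * N <= s * (N - (m + e)))%N.
  rewrite -(ler_nat R) !natrM natrB // natrD.
  have : (1 - eps) / 2 * N%:R * s%:R <= (N%:R - (m%:R + e%:R)) * s%:R.
    by rewrite ler_wpM2r ?ler0n //; lra.
  have : 4 * N%:R <= (1 - eps) * s%:R * N%:R by rewrite ler_wpM2r ?ler0n.
  lra.
have NL : nR <= N%:R *+ 2 :> R.
  apply: le_trans (proj1 N_bounds).
  by rewrite -[leLHS]mulr1 ler_wpM2l ?ler0n // exprn_ege1 // y_ge1.
have big : 1 <= eta * (2 ^ N)%:R.
  have etaN : 1 <= eta * N%:R by have := ler_wpM2l (ltW eta0) NL; lra.
  by apply: le_trans etaN _; rewrite ler_wpM2l ?(ltW eta0) // ler_nat ltnW // ltn_expl.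
have pow : (2 ^ N * 2 ^ N <= n ^ (N - (m + e)))%N.
  rewrite -expnD addnn -mul2n; apply: leq_trans (leq_pexp2l _ key) _ => //.
  by rewrite expnM; case: (N - _)%N => // i; rewrite leq_exp2r.
have -> : (n ^ N = n ^ m * n ^ e * n ^ (N - (m + e)))%N by rewrite -!expnD subnKC.
rewrite mulnCA mulnC natrM (natrM _ (n ^ m * n ^ e)) mulrCA.
rewrite ler_wpM2l ?ler0n //.
apply: le_trans (_ : eta * (2 ^ N * 2 ^ N)%:R <= _); last first.
  by rewrite ler_wpM2l ?ler_nat // ltW.
by rewrite natrM mulrA ler_peMl ?ler0n.
Qed.

End Asymptotics.

Lemma powR_threshold (R : realType) (alpha K : R) (n : nat) : 0 < alpha -> 0 <= K ->
  (Num.truncn (K `^ (4 / alpha)) < n)%N -> K <= n%:R `^ (alpha / 4).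
Proof.
move=> a0 K0 Kn.
have -> : K = (K `^ (4 / alpha)) `^ (alpha / 4).
  by rewrite -powRrM [4 / alpha * _](_ : _ = 1) ?powRr1 //; field; rewrite lt0r_neq0.
apply: ge0_ler_powR; rewrite ?nnegrE ?powR_ge0 ?ler0n // ?divr_ge0 ?ltW //.
by apply: lt_le_trans (truncnS_gt _) _; rewrite ler_nat.
Qed.

Lemma terms_le_sum (R : realType) (a b c d e : R) :
    0 <= a -> 0 <= b -> 0 <= c -> 0 <= d -> 0 <= e ->
  [/\ a <= a + b + c + d + e, b <= a + b + c + d + e, c <= a + b + c + d + e,
      d <= a + b + c + d + e & e <= a + b + c + d + e].
Proof. by move=> *; split; lra. Qed.

Theorem theorem6p7 (R : realType) (alpha : R) (alpha01 : 0 < alpha < 1) :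
  exists beta : R, 0 < beta < 1 /\
  exists (C : R -> R) (d : R -> nat) (c : R -> R -> R) (n0 : R -> R -> nat),
  (forall eps delta : R, 0 < c eps delta) /\
  forall n k : nat, k%:R <= n%:R `^ beta ->
  exists Pi : {set word n (block_length alpha n)},
  forall eps : R, 0 < eps <= 1 ->
    (exists (q : nat) (T : algorithm R n (block_length alpha n)),
       [/\ round_adaptive_tester k q Pi eps T,
           one_sided T k Pi
         & (0 < k)%N -> q%:R <= C eps * (k%:R * (1 + ln k%:R) ^+ d eps)])
    /\
    (eps < 1 ->
     forall delta : R, 0 < delta < 2^-1 -> (n0 eps delta <= n)%N ->
     forall (q : nat) (T : algorithm R n (block_length alpha n)),
       tail_adaptive_tester k q Pi eps delta T ->
       c eps delta * n%:R <= q%:R).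
Proof.
have /andP[a0 a1] := alpha01.
exists (alpha / 4); split; first lra.
pose t := max_hits alpha.
pose eta (delta : R) : R := (1 - 2 * delta) / 4.
pose s (eps : R) := (Num.truncn (4 / (1 - eps))).+1.
pose K (eps delta : R) : R := 36 * t%:R + 72 * t%:R / (1 - eps) + (2 ^ s eps)%:R +
  2 / eta delta + 2 * (6 * t%:R) ^+ t.+1 / eta delta.
pose r (eps : R) := (Num.truncn (2 / eps)).+1.
exists (fun eps => (r eps * (4 + 6 * t))%:R), (fun=> 0%N), (fun _ _ => 1),
  (fun eps delta => (Num.truncn (K eps delta `^ (4 / alpha))).+1).
split=> [_ _|n k kn]; first exact: ltr01.
have K_le eps delta : eps < 1 -> 0 < delta < 2^-1 ->
    (Num.truncn (K eps delta `^ (4 / alpha)) < n)%N ->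
  [/\ 0 < eta delta, K eps delta <= n%:R `^ (alpha / 4) & [/\
    36 * t%:R <= K eps delta, 72 * t%:R / (1 - eps) <= K eps delta,
    (2 ^ s eps)%:R <= K eps delta, 2 / eta delta <= K eps delta &
    2 * (6 * t%:R) ^+ t.+1 / eta delta <= K eps delta]].
  move=> e1 /andP[d0 d1] nK.
  have eta0 : 0 < eta delta by rewrite /eta; lra.
  have e1' : 0 <= 1 - eps by lra.
  have pos : [/\ 0 <= 36 * t%:R :> R, 0 <= 72 * t%:R / (1 - eps) , 0 <= 2 / eta delta
      & 0 <= 2 * (6 * t%:R) ^+ t.+1 / eta delta].
    have eta0' := ltW eta0.
    split; [by rewrite mulr_ge0 | by rewrite divr_ge0 // mulr_ge0 | exact: divr_ge0 |].
    by apply: divr_ge0 => //; apply: mulr_ge0 => //; apply: exprn_ge0; rewrite mulr_ge0.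
  have [p1 p2 p4 p5] := pos.
  have le5 := terms_le_sum p1 p2 (ler0n R (2 ^ s eps)) p4 p5.
  split=> //; apply: powR_threshold => //.
  by have [h _ _ _ _] := le5; apply: le_trans p1 h.
have [hy|hy] := lerP (36 * t%:R) (n%:R `^ (alpha / 4)); last first.
  exists setT => eps e01; have /andP[e0 e1] := e01; split.
    have any (v w : word n (block_length alpha n)) :
        agree set0 v w -> v \in setT -> w \in setT by rewrite !in_setT.
    have [tst os] := one_round_tester any k e0.
    exists #|@set0 'I_(block_length alpha n)|, (one_round R setT set0).
    by split=> // _; rewrite cards0 expr0 mulr1 mulr_ge0.
  move=> e1' delta d01 nK; have [_ Ky [K1 _ _ _ _]] := K_le _ _ e1' d01 nK.
  by have := le_lt_trans (le_trans K1 Ky) hy; rewrite ltxx.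
case: n kn K_le hy => [|n'] kn K_le hy.
  exfalso; move: hy; rewrite powR0 ?lt0r_neq0 ?divr_gt0 // leNgt.
  by rewrite mulr_gt0 // ltr0n.
have n_ge1 : 1 <= n'.+1%:R :> R by rewrite ler1n.
set N := block_length alpha n'.+1.
have N0 : (0 < N)%N.
  have [h _] := N_bounds alpha01 n_ge1; rewrite -(ltr0n R).
  have : 0 < n'.+1%:R * (n'.+1%:R `^ (alpha / 4)) ^+ 4 :> R.
    by rewrite mulr_gt0 ?exprn_gt0 ?powR_gt0 ?ltr0n.
  by move=> h0; have := lt_le_trans h0 h; rewrite pmulrn_lgt0.
have auxN : (#|aux (table_count alpha k) (table_size alpha n'.+1)
    (block_count alpha n'.+1)| <= N)%N.
  rewrite -(ler_nat R) -[leRHS]mul1r; apply: aux_small => //.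
  by rewrite mul1r.
have blocksN := N_le_blocks alpha n'.+1.
exists (codewords n' auxN) => eps e01; have /andP[e0 e1] := e01; split.
  have er : 2 <= eps * (r eps)%:R.
    by rewrite mulrC -ler_pdivrMr //; apply/ltW/truncnS_gt.
  have [q [A [tst os qle]]] := codewords_tester n' auxN k N0 e01 er.
  exists q, A; split=> // k0; rewrite expr0 mulr1 -natrM ler_nat.
  apply: leq_trans (qle k0) _; rewrite -mulnA leq_mul2l; apply/orP; right.
  by rewrite /table_count -/t; nia.
move=> e1' delta d01 nK q A tst; rewrite mul1r ler_nat leqNgt; apply/negP => qn.
have [eta0 Ky [K1 K2 K3 K4 K5]] := K_le _ _ e1' d01 nK.
have Kn : K eps delta <= n'.+1%:R.
  apply: le_trans Ky _; apply: le_trans (y4_le alpha01 n_ge1).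
  by rewrite ler_eXnr // y_ge1.
have e1p : 0 < 1 - eps by lra.
have bad : 2 * (6 * t%:R) ^+ t.+1 <= eta delta * n'.+1%:R.
  by rewrite -ler_pdivrMl // [leLHS]mulrC (le_trans K5).
have near : (n'.+1 ^ #|aux (table_count alpha k) (table_size alpha n'.+1)
    (block_count alpha n'.+1)| * (2 ^ N * n'.+1 ^ Num.truncn (eps * N%:R)))%:R
    <= eta delta * (n'.+1 ^ N)%:R.
  apply: (near_small (s := s eps) alpha01 n_ge1) => //; first exact/andP.
  - apply: aux_small => //.
    have := le_trans K2 Ky; rewrite ler_pdivrMr //.
    by clear; lra.
  - by rewrite mulrC -ler_pdivrMr //; apply/ltW/truncnS_gt.
  - by rewrite -(ler_nat R) (le_trans K3).
  - by rewrite mulrC -ler_pdivrMr // (le_trans K4).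
have err := tail_adaptive_error blocksN N0 (ltW e0) (ltnSn _) (ltnW qn)
  (not_good_small alpha01 n_ge1 kn eta0 bad) near tst.
have /andP[_ d1] := d01.
by move: err d1; rewrite /eta; clear; lra.
Qed.
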